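(* Let $k$ be a rational number with $k\not\equiv0,4,5,11\pmod{12}$. For the connection matrices $M(t)$ and $N(r,s)$, the commutativity relation $M(t)N(r,s)=N(r,s)M(t)$ holds if and only if one of the following conditions is satisfied: (1) $K_tK_{r,s}=0$; (2) $Z_r=Z_s=1$ (in this case, $N(1,1)=E$, which commutes with any $M(t)$); (3) $Z_t=Z_r=Z_s$ (in this case, $N(t,t)=M(t)^2$, which trivially commutes).
   Context: For rational $k$ and integer $m$, ''$k\equiv m\pmod{12}$'' means $k-m\in12\mathbb{Z}$. Put $\theta=\frac{1+k}{6}\pi$, $C=\csc\theta$, and for $l\in\mathbb{Z}$, $Z_l=e^{2li\theta}$, $W_l=(Z_l-1)C$. Put $K_t=W_t^2+4Z_t$, $K_{r,s}=W_rW_s+4(Z_r+Z_s)$, $$G_{12}=\frac{\sqrt\pi\,\Gamma(\frac{1+k}{6})}{4\Gamma(\frac{2+k}{12})\Gamma(\frac{6+k}{12})},\qquad G_{21}=\frac{\sqrt\pi\,\Gamma(\frac{5-k}{6})}{2\Gamma(\frac{6-k}{12})\Gamma(\frac{10-k}{12})},$$ and $$\rho(T)=\begin{pmatrix}1&4iG_{12}(1-Z_1)\\0&Z_1\end{pmatrix},\qquad\rho(S)=\begin{pmatrix}-1&0\\-4iG_{21}&1\end{pmatrix}.$$ The connection matrices are $M(t)=(\rho(T)^t\rho(S))^3$ for integers $t\ne0$, and $N(r,s)=(\rho(T)^r\rho(S)\rho(T)^s\rho(S))^2$ for integers $r\ne1$, $s\ne1$. $E$ is the $2\times2$ identity matrix.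 In condition (2) the notation $N(1,1)$ refers to $N(r,s)$ when $Z_r=Z_s=1$ (the entries 1 being values of $Z_r,Z_s$).
   Formalization: The formal theorem also excludes k ≡ 6, 10 (mod 12), where a Gamma factor in G_12 or G_21 has a pole and the equivalence fails (k=6, t=3, r=-2, s=2); in (3) the false N(t,t)=M(t)^2 is replaced by N(r,s)=(ρ(T)^tρ(S))^4. *)

(* Defs.v *)
From HB Require Import structures.
From mathcomp Require Import all_boot all_order all_algebra.
From mathcomp Require Import all_classical all_reals all_analysis.
From mathcomp Require Import complex.

Set Implicit Arguments.
Unset Strict Implicit.
Unset Printing Implicit Defensive.

Import Order.TTheory GRing.Theory Num.Theory.
Import numFieldNormedType.Exports.

Local Open Scope classical_set_scope.
Local Open Scope ring_scope.
Local Open Scope complex_scope.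

Definition cong12 (k : rat) (m : int) : Prop :=
  exists z : int, k - m%:~R = 12 * z%:~R.

(* Gauss's limit n^x n! / (x (x+1) ... (x+n)), which converges to Gamma(x) for
   every real x that is not a pole.  At a pole the factor x + i = 0 makes the
   terms 0 for large n (as 0^-1 = 0), so Gamma and 1 / Gamma both take the
   value 0 there. *)
Definition Gamma_seq (R : realType) (x : R) : R^nat :=
  fun n => n%:R `^ x * n`!%:R / \prod_(i < n.+1) (x + i%:R).

Definition Gamma (R : realType) (x : R) : R := limn (Gamma_seq x).

Definition Gamma_pole (x : rat) : Prop := exists n : nat, x = - n%:R.

Section Connection.
Variables (R : realType) (k : rat).

Let kR : R := ratr k.

Definition theta : R := (1 + kR) / 6 * pi.

Definition cscC : R[i] := ((sin theta)^-1)%:C.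

Definition Zc (l : int) : R[i] :=
  cos (2 * l%:~R * theta) +i* sin (2 * l%:~R * theta).

Definition Wc (l : int) : R[i] := (Zc l - 1) * cscC.

Definition K1 (t : int) : R[i] := Wc t ^+ 2 + 4 * Zc t.

Definition K2 (r s : int) : R[i] := Wc r * Wc s + 4 * (Zc r + Zc s).

Definition G12 : R :=
  Num.sqrt pi * Gamma ((1 + kR) / 6)
  / (4 * Gamma ((2 + kR) / 12) * Gamma ((6 + kR) / 12)).

Definition G21 : R :=
  Num.sqrt pi * Gamma ((5 - kR) / 6)
  / (2 * Gamma ((6 - kR) / 12) * Gamma ((10 - kR) / 12)).

Definition mx2 (a b c d : R[i]) : 'M[R[i]]_2 :=
  \matrix_(i, j) if i == 0 then (if j == 0 then a else b)
                 else (if j == 0 then c else d).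

Definition rhoT : 'M[R[i]]_2 :=
  mx2 1 (4 * (0 +i* 1) * G12%:C * (1 - Zc 1))
      0 (Zc 1).

Definition rhoS : 'M[R[i]]_2 :=
  mx2 (- 1)                       0
      (- (4 * (0 +i* 1) * G21%:C)) 1.

Definition Mconn (t : int) : 'M[R[i]]_2 := (rhoT ^ t * rhoS) ^+ 3.

Definition Nconn (r s : int) : 'M[R[i]]_2 :=
  (rhoT ^ r * rhoS * rhoT ^ s * rhoS) ^+ 2.

End Connection.

(* The formulas for G12 and G21 are meaningful: no Gamma function occurring in
   them is evaluated at a pole.  For the two denominators this rules out
   k = 6, 10 mod 12, where setting 1 / Gamma = 0 would give G12 * G21 = 0. *)
Definition G_defined (k : rat) : Prop :=
  forall x : rat,
    x \in [:: (1 + k) / 6; (2 + k) / 12; (6 + k) / 12;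
              (5 - k) / 6; (6 - k) / 12; (10 - k) / 12] ->
    ~ Gamma_pole x.

(* Main.v *)
(* With A = T^t S and B = T^r S T^s S, Cayley-Hamilton gives
   A^3 = ((tr A)^2 - det A) A + scalar and B^2 = (tr B) B + scalar, so that
   [M(t), N(r, s)] = ((tr A)^2 - det A) (tr B) [A, B].  The reflection formula
   turns 16 G12 G21 into 1 + C / 2, whence (tr A)^2 - det A = K_t / 4 and
   tr B = K_{r,s} / 4.  Writing y = C / 2, u = Z_r, v = Z_s, w = Z_t, two entries
   of [A, B] = 0 read y (1 - v) (u - w) = w (v - u) and
   y^2 (1 - v) (u - w) = w (v - u); as y <> 1 when k is not 0 or 4 mod 12, this
   forces v = 1 or u = w, and then u = v.

   The reflection formula for Gauss's limit rests on the sine product.  Halving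
   the angle n times gives, for m = 2^n and y = x / 2m,
   sin x = 2m sin y cos y prod_{0 < j < m} (1 - sin^2 y / sin^2 (j pi / 2m)).
   Since sin t / t decreases and tan t / t increases, each factor lies between
   cos^2 y (1 - (x / j pi)^2) and 1 - (x / j pi)^2, and the partial products of
   Euler's formula are squeezed. *)
Require Import Defs.
From HB Require Import structures.
From mathcomp Require Import all_boot all_order all_algebra.
From mathcomp Require Import all_classical all_reals all_analysis.
From mathcomp Require Import complex zify ring lra.

Set Implicit Arguments.
Unset Strict Implicit.
Unset Printing Implicit Defensive.

Import Order.TTheory GRing.Theory Num.Theory.
Import numFieldNormedType.Exports.
Local Open Scope classical_set_scope.
Local Open Scope ring_scope.


(** * Euler's product for the sine *)

Lemma derive_ge0_le (R : realType) (f df : R -> R) (a b : R) :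
  (forall x : R, is_derive x 1 f (df x)) -> (forall x, a < x < b -> 0 <= df x) ->
  a <= b -> f a <= f b.
Proof.
move=> Df df_ge0; rewrite le_eqVlt => /predU1P[->//|ab].
have cf : {within `[a, b], continuous f}.
  apply: continuous_subspaceT => x; apply: differentiable_continuous.
  by apply/derivable1_diffP; have [] := Df x.
have [c cab e] := MVT ab (fun x _ => Df x) cf.
by rewrite -subr_ge0 e mulr_ge0 ?subr_ge0 ?(ltW ab) ?df_ge0 // -in_itv.
Qed.

Lemma sin_le_id (R : realType) (x : R) : 0 <= x -> sin x <= x.
Proof.
move=> x0; rewrite -subr_ge0.
have := @derive_ge0_le R (fun y => y - sin y) (fun y => 1 - cos y) 0 x.
by rewrite sin0 subr0; apply.
Qed.

Lemma mul_cos_le_sin (R : realType) (x : R) : 0 <= x <= pi -> x * cos x <= sin x.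
Proof.
move=> /andP[x0 xpi]; rewrite -subr_ge0.
have := @derive_ge0_le R (fun y => sin y - y * cos y) (fun y => y * sin y) 0 x.
rewrite sin0 mul0r subr0; apply => // y => [|/andP[y0 yx]].
  apply: is_derive_eq; rewrite /GRing.scale/=; ring.
by rewrite mulr_ge0 ?sin_ge0_pi ?(ltW y0) //= (le_trans (ltW yx)).
Qed.

Lemma one_sub_sqr_half_le_cos (R : realType) (x : R) : 0 <= x ->
  1 - x ^+ 2 / 2 <= cos x.
Proof.
move=> x0.
have -> : cos x = 1 - 2 * sin (x / 2) ^+ 2.
  have {1}-> : x = (x / 2) *+ 2 by rewrite mulr2n; field.
  rewrite cos_mulr2n sin2cos2 mulr2n; ring.
have h0 : 0 <= x / 2 by rewrite divr_ge0.
(* Since [x] has no upper bound, [sin (x / 2)] may be negative; its square is then controlled by the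
   lower bound [- (x / 2)]. *)
have := sin_le_id h0; have [s0|s0] := lerP 0 (sin (x / 2)).
  by move=> s; nra.
have : - (x / 2) <= sin (x / 2).
  rewrite lerNl -sinN.
  have := @derive_ge0_le R (fun y => y + sin y) (fun y => 1 + cos y) 0 (x / 2).
  rewrite sin0 addr0 sinN => H.
  rewrite -subr_ge0 opprK; apply: H => //.
nra.
Qed.

(** Decrease of sin t / t, multiplied out. With [a] fixed, the derivative in [b] of the difference
    is sin a - a cos b, which is at least a (cos a - cos b) >= 0. *)
Lemma sin_ratio_ge (R : realType) (a b : R) : 0 <= a -> a <= b -> b <= pi ->
  a * sin b <= b * sin a.
Proof.
move=> a0 ab bpi; rewrite -subr_ge0.
have := @derive_ge0_le R (fun y => y * sin a - a * sin y)
  (fun y => sin a - a * cos y) a b.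
rewrite subrr; apply => // y => [|/andP[ay yb]].
  apply: is_derive_eq; rewrite /GRing.scale/=; ring.
have api : a <= pi by exact: le_trans bpi.
have ypi : y <= pi by rewrite (le_trans (ltW yb)).
rewrite subr_ge0 (le_trans _ (@mul_cos_le_sin R a _)) ?a0 //.
apply: ler_wpM2l => //.
have [h|h] := lerP y a; first by move: ay; rewrite ltNge h.
by rewrite ltW // ltr_cos // in_itv /= ?a0 ?api // (le_trans a0 (ltW ay)).
Qed.

(** Increase of tan t / t, multiplied out so that [b = pi / 2] is allowed. *)
Lemma tan_ratio_le (R : realType) (a b : R) : 0 <= a -> a <= b -> b <= pi / 2 ->
  b * (sin a * cos b) <= a * (sin b * cos a).
Proof.
move=> a0 ab bpi; rewrite -subr_ge0.
have pi0 := pi_gt0 R.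
have := @derive_ge0_le R (fun y => a * (sin y * cos a) - y * (sin a * cos y))
  (fun y => a * cos y * cos a - sin a * cos y + y * sin a * sin y) a b.
rewrite subrr; apply => // y => [|/andP[ay yb]].
  apply: is_derive_eq; rewrite /GRing.scale/=; ring.
have api : a <= pi by lra.
have sa0 : 0 <= sin a by rewrite sin_ge0_pi // a0.
have sle : sin a <= a := sin_le_id a0.
have cle : a * cos a <= sin a by rewrite mul_cos_le_sin // a0.
have cya : cos y <= cos a.
  by rewrite ltW // ltr_cos // in_itv /=; apply/andP; split; lra.
have say : sin a <= sin y.
  by rewrite ltW // ltr_sin // in_itv /=; apply/andP; split; lra.
(* [h1] and [h2] bound the derivative below by its value at [y = a], which is a - sin a cos a >=
   0. *)
have h1 : cos a * (sin a - a * cos a) >= cos y * (sin a - a * cos a).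
  by rewrite ler_wpM2r // subr_ge0.
have h2 : a * (sin a * sin a) <= y * (sin a * sin y).
  by rewrite ler_pM // ?mulr_ge0 // ?(ltW ay) // ler_wpM2l.
have h3 := cos2Dsin2 a.
have c1 : cos a * sin a <= a.
  by rewrite (le_trans _ sle) // ler_piMl // cos_le1.
have : a * (cos a ^+ 2 + sin a ^+ 2) = a by rewrite h3 mulr1.
nra.
Qed.

(** * The finite sine product by repeated halving of the angle *)

Lemma prod_nat_fold (R : comRingType) (F : nat -> R) (m : nat) : (0 < m)%N ->
  \prod_(1 <= j < m.*2) F j = F m * \prod_(1 <= j < m) (F j * F (m.*2 - j)%N).
Proof.
move=> m0; rewrite (@big_cat_nat _ _ _ m) //=; last by rewrite -addnn leq_addr.
rewrite [X in _ * X]big_ltn; last by rewrite -addnn -[X in (X < _)%N]addn0 ltn_add2l.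
rewrite mulrCA big_split /=; congr (_ * (_ * _)).
rewrite big_nat_rev /= -{1}[m.+1]add1n big_addn.
rewrite (_ : (m.*2 - m)%N = m); last by rewrite -addnn addnK.
apply: eq_big_nat => i /andP[i1 im]; congr F; rewrite -addnn; lia.
Qed.

(** Rests on 1 / (sin^2 b cos^2 b) = 1 / sin^2 b + 1 / cos^2 b. The second factor on the right is
    the first one taken at pi / 2 - b. *)
Lemma sin_ratio_double (R : realType) (y b : R) : sin b != 0 -> cos b != 0 ->
  1 - sin (2 * y) ^+ 2 / sin (2 * b) ^+ 2 =
  (1 - sin y ^+ 2 / sin b ^+ 2) * (1 - sin y ^+ 2 / cos b ^+ 2).
Proof.
move=> sb cb; rewrite ![2 * _]mulr_natl !sin_mulr2n.
have := cos2Dsin2 y; have := cos2Dsin2 b.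
move: (sin y) (cos y) (sin b) (cos b) sb cb => s c s' c' sb cb e e'.
have -> : (c * s) *+ 2 = 2 * (c * s) by rewrite mulr2n; ring.
have -> : (c' * s') *+ 2 = 2 * (c' * s') by rewrite mulr2n; ring.
have e1 : c ^+ 2 = 1 - s ^+ 2 by rewrite -e'; ring.
have e2 : s' ^+ 2 = 1 - c' ^+ 2 by rewrite -e; ring.
have -> : (2 * (c * s)) ^+ 2 / (2 * (c' * s')) ^+ 2 =
    c ^+ 2 * s ^+ 2 / (c' ^+ 2 * s' ^+ 2).
  by field; rewrite sb cb.
rewrite e1.
transitivity (1 - (s ^+ 2 / (c' ^+ 2 * s' ^+ 2)) * (c' ^+ 2 + s' ^+ 2) +
  s ^+ 2 / s' ^+ 2 * (s ^+ 2 / c' ^+ 2)).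
  by rewrite e; field; rewrite sb cb.
by field; rewrite sb cb.
Qed.

(** Induction on [n]: doubling [m] splits the factor of index [j] into those of indices [j] and
    [2m - j], whose angles are complementary. The new middle factor, of index [m], is cos (2 y),
    because sin^2 (pi / 4) = 1 / 2. *)
Lemma sin_prod (R : realType) (x : R) (n : nat) (m := (2 ^ n)%N)
    (y := x / (2 * m%:R)) :
  sin x = 2 * m%:R * sin y * cos y *
    \prod_(1 <= j < m) (1 - sin y ^+ 2 / sin (j%:R * pi / (2 * m%:R)) ^+ 2).
Proof.
rewrite {}/y {}/m; elim: n => [|n IHn].
  rewrite expn0 big_geq // !mulr1 {1}(_ : x = (x / 2) *+ 2).
    by rewrite sin_mulr2n mulr2n; ring.
  by rewrite mulr2n; field.
rewrite {}IHn expnS mul2n.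
have m0 : (0 < 2 ^ n)%N by rewrite expn_gt0.
move: (2 ^ n)%N m0 => m m0; rewrite prod_nat_fold // -mul2n natrM.
have mR : (m%:R : R) != 0 by rewrite pnatr_eq0 -lt0n.
have pi0 := pi_gt0 R.
set y := x / (2 * (2 * m%:R)).
have -> : x / (2 * m%:R) = 2 * y by rewrite /y; field.
have -> : m%:R * pi / (2 * (2 * m%:R)) = pi / 4 :> R by field.
have s4 : sin (pi / 4 : R) ^+ 2 = 1 / 2.
  have := cos_pihalf R; rewrite (_ : pi / 2 = (pi / 4) *+ 2 :> R); last by rewrite mulr2n; field.
  by rewrite cos_mulr2n cos2sin2 mulr2n; lra.
rewrite s4.
have -> : \prod_(1 <= j < m) (1 - sin (2 * y) ^+ 2 / sin (j%:R * pi / (2 * m%:R)) ^+ 2)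
  = \prod_(1 <= j < m) ((1 - sin y ^+ 2 / sin (j%:R * pi / (2 * (2 * m%:R))) ^+ 2) *
     (1 - sin y ^+ 2 / sin ((2 * m - j)%:R * pi / (2 * (2 * m%:R))) ^+ 2)).
  apply: eq_big_nat => j /andP[j1 jm].
  pose b := j%:R * pi / (2 * (2 * m%:R)) : R.
  have -> : j%:R * pi / (2 * m%:R) = 2 * b by rewrite /b; field.
  have -> : (2 * m - j)%:R * pi / (2 * (2 * m%:R)) = pi / 2 - b.
    rewrite natrB; last lia.
    by rewrite natrM /b; field.
  rewrite -/b sinB sin_pihalf cos_pihalf mul1r mul0r subr0.
  have j0 : (0 : R) < j%:R by rewrite ltr0n.
  have m0R : (0 : R) < m%:R by rewrite ltr0n.
  have jmR : (j%:R : R) < m%:R by rewrite ltr_nat.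
  have b0 : 0 < b by rewrite /b divr_gt0 ?mulr_gt0.
  have bpi : b < pi / 2.
    rewrite /b ltr_pdivrMr ?mulr_gt0 // (_ : pi / 2 * _ = 2 * m%:R * pi); last by field.
    by rewrite ltr_pM2r //; lra.
  rewrite sin_ratio_double //.
    by rewrite gt_eqF // sin_gt0_pihalf // b0.
  by rewrite gt_eqF // cos_gt0_pihalf // bpi andbT (lt_trans _ b0) // oppr_lt0 divr_gt0.
have -> : sin (2 * y) = 2 * (cos y * sin y) by rewrite mulr_natl sin_mulr2n mulr_natl.
have -> : cos (2 * y) = 1 - sin y ^+ 2 / (1 / 2).
  by rewrite mulr_natl cos_mulr2n cos2sin2 mulr2n; field.
ring.
Qed.

(** * Squeezing the partial products of Euler's formula *)

Lemma bernoulli_sub_le (R : realFieldType) (u : R) (n : nat) : 0 <= u <= 1 ->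
  1 - n%:R * u <= (1 - u) ^+ n.
Proof.
move=> /andP[u0 u1]; elim: n => [|n IHn]; first by rewrite mul0r subr0 expr0.
rewrite exprS -natr1; have n0 : (0 : R) <= n%:R by [].
have : (1 - u) * (1 - n%:R * u) <= (1 - u) * (1 - u) ^+ n.
  by rewrite ler_wpM2l // subr_ge0.
have : 0 <= n%:R * u * u by rewrite !mulr_ge0.
nra.
Qed.

Lemma sin_ratio_bounds (R : realType) (y b : R) :
  0 <= y -> y <= b -> 0 < b -> b < pi / 2 ->
  [/\ 0 <= 1 - (y / b) ^+ 2,
      0 <= 1 - sin y ^+ 2 / sin b ^+ 2,
      1 - sin y ^+ 2 / sin b ^+ 2 <= 1 - (y / b) ^+ 2 &
      cos y ^+ 2 * (1 - (y / b) ^+ 2) <= 1 - sin y ^+ 2 / sin b ^+ 2].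
Proof.
move=> y0 yb b0 bpi; have pi0 := pi_gt0 R.
have sb0 : 0 < sin b by rewrite sin_gt0_pihalf // b0.
have cb0 : 0 < cos b by rewrite cos_gt0_pihalf // bpi andbT; lra.
have cy0 : 0 < cos y by rewrite cos_gt0_pihalf //; apply/andP; split; lra.
have sy0 : 0 <= sin y by apply: sin_ge0_pi; apply/andP; split; lra.
have q0 : 0 <= y / b by rewrite divr_ge0 // ltW.
have r0 : 0 <= sin y / sin b by rewrite divr_ge0 // ltW.
have q1 : y / b <= 1 by rewrite ler_pdivrMr // mul1r.
have qr : y / b <= sin y / sin b.
  rewrite ler_pdivrMr // mulrAC ler_pdivlMr // [sin y * b]mulrC.
  by apply: sin_ratio_ge => //; lra.
have r1 : sin y / sin b <= 1.
  rewrite ler_pdivrMr // mul1r.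
  move: yb; rewrite le_eqVlt => /predU1P[->//|yb]; apply/ltW.
  by rewrite ltr_sin // in_itv /=; apply/andP; split; lra.
have rc : sin y / sin b * cos b <= y / b * cos y.
  rewrite mulrAC ler_pdivrMr // mulrAC mulrAC [X in _ <= X](_ : _ = y * (sin b * cos y) / b); last by ring.
  by rewrite ler_pdivlMr // mulrC tan_ratio_le // ltW.
have c0 : 0 <= sin y / sin b * cos b by rewrite mulr_ge0 // ltW.
(* Replacing cos^2 b by 1 - sin^2 b turns this into (sin y / sin b)^2 <= sin^2 y + (y / b)^2 cos^2
   y, which is the last bound. *)
have rc2 : (sin y / sin b * cos b) ^+ 2 <= (y / b * cos y) ^+ 2.
  by rewrite ler_sqr ?nnegrE // mulr_ge0 // ltW.
have rs : (sin y / sin b * cos b) ^+ 2 = (sin y / sin b) ^+ 2 - sin y ^+ 2.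
  by rewrite exprMn [cos b ^+ 2]cos2sin2; field; rewrite gt_eqF.
rewrite -expr_div_n; split.
- by rewrite subr_ge0 expr_le1.
- by rewrite subr_ge0 expr_le1.
- by rewrite lerD2l lerN2 ler_sqr ?nnegrE.
- by have := cos2Dsin2 y; move: rc2; rewrite rs [(y / b * _) ^+ 2]exprMn; lra.
Qed.

(** Euler's product for sin x / x, cut off before the index [m]. *)
Definition sin_partial_prod (R : realType) (x : R) (m : nat) : R :=
  \prod_(1 <= j < m) (1 - (x / (j%:R * pi)) ^+ 2).

Lemma sin_partial_prod_factor (R : realType) (x : R) (j : nat) :
  0 < x < pi -> (0 < j)%N ->
  0 <= 1 - (x / (j%:R * pi)) ^+ 2 <= 1.
Proof.
move=> /andP[x0 xpi] j0; have pi0 := pi_gt0 R.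
have j1 : (1 : R) <= j%:R by rewrite ler1n.
have jpi : 0 < j%:R * pi :> R by rewrite mulr_gt0 // ltr0n.
have q0 : 0 <= x / (j%:R * pi) by rewrite divr_ge0 // ltW.
rewrite subr_ge0 gerBl sqr_ge0 andbT expr_le1 // ler_pdivrMr // mul1r.
by rewrite (le_trans (ltW xpi)) // ler_peMl // ltW.
Qed.

(** Here x = 2 m y. Above, 2 m sin y cos y <= x. Below, sin y >= y cos y and the m - 1 factors lose
    cos^(2m) y in total, and cos^(2m) y >= (1 - y^2 / 2)^(2m) >= 1 - m y^2 = 1 - x^2 / (4 m). *)
Lemma sin_partial_prod_bounds (R : realType) (x : R) (n : nat)
    (m := (2 ^ n)%N) : 0 < x < pi ->
  sin x <= x * sin_partial_prod x m /\
  x * sin_partial_prod x m * (1 - x ^+ 2 / (4 * m%:R)) <= sin x.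
Proof.
move=> /andP[x0 xpi]; rewrite (sin_prod x n) /sin_partial_prod.
have : (0 < m)%N by rewrite expn_gt0.
rewrite -/m; move: (m) => {}m m0.
have mR : (0 : R) < m%:R by rewrite ltr0n.
have m1 : (1 : R) <= m%:R by rewrite ler1n.
set y := x / (2 * m%:R); have pi0 := pi_gt0 R.
have y0 : 0 < y by rewrite divr_gt0 // mulr_gt0.
have xy : x = 2 * m%:R * y by rewrite /y; field; rewrite gt_eqF.
have ypi : y < pi / 2 by rewrite xy in xpi; nra.
have sy0 : 0 < sin y by rewrite sin_gt0_pihalf // y0.
have cy0 : 0 < cos y by rewrite cos_gt0_pihalf // ypi andbT; lra.
have bnd j : (1 <= j < m)%N ->
  [/\ 0 <= 1 - (x / (j%:R * pi)) ^+ 2,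
      0 <= 1 - sin y ^+ 2 / sin (j%:R * pi / (2 * m%:R)) ^+ 2,
      1 - sin y ^+ 2 / sin (j%:R * pi / (2 * m%:R)) ^+ 2 <=
        1 - (x / (j%:R * pi)) ^+ 2 &
      cos y ^+ 2 * (1 - (x / (j%:R * pi)) ^+ 2) <=
        1 - sin y ^+ 2 / sin (j%:R * pi / (2 * m%:R)) ^+ 2].
  move=> /andP[j1 jm].
  have jR1 : (1 : R) <= j%:R by rewrite ler1n.
  have jmR : (j%:R : R) < m%:R by rewrite ltr_nat.
  pose b := j%:R * pi / (2 * m%:R) : R.
  have b0 : 0 < b by rewrite /b divr_gt0 // mulr_gt0 //; lra.
  have -> : x / (j%:R * pi) = y / b.
    by rewrite /y /b; field; rewrite !gt_eqF //; lra.
  apply: sin_ratio_bounds => //; first exact: ltW.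
    rewrite /y /b ler_pM2r ?invr_gt0 ?mulr_gt0 //; nra.
  rewrite /b ltr_pdivrMr ?mulr_gt0 // (_ : pi / 2 * _ = m%:R * pi); last by field.
  by rewrite ltr_pM2r.
set A := \prod_(1 <= j < m) (1 - (x / (j%:R * pi)) ^+ 2).
set B := \prod_(1 <= j < m) _.
have A0 : 0 <= A.
  by rewrite /A big_seq; apply: prodr_ge0 => j; rewrite mem_index_iota => /bnd[].
have BA : B <= A.
  rewrite /A /B big_seq [X in _ <= X]big_seq; apply: ler_prod => j.
  by rewrite mem_index_iota => /bnd[? -> ->].
have AB : (cos y ^+ 2) ^+ (m - 1) * A <= B.
  rewrite -prodr_const_nat /A /B -big_split /= big_seq [X in _ <= X]big_seq.
  apply: ler_prod => j; rewrite mem_index_iota => /bnd[h1 h2 h3 h4].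
  by rewrite h4 mulr_ge0 // sqr_ge0.
split.
  rewrite xy; apply: ler_pM => //.
  - by rewrite !mulr_ge0 // ltW.
  - by rewrite (le_trans _ AB) // mulr_ge0 // exprn_ge0 // sqr_ge0.
  - rewrite -[X in _ <= X]mulr1; apply: ler_pM => //; rewrite ?cos_le1 ?mulr_ge0 ?(ltW sy0) ?(ltW cy0) //.
    by rewrite ler_wpM2l ?mulr_ge0 // sin_le_id // ltW.
have ys : y * cos y <= sin y by rewrite mul_cos_le_sin // (ltW y0); lra.
have cosB : 1 - x ^+ 2 / (4 * m%:R) <= (cos y ^+ 2) ^+ m.
  rewrite -exprM.
  have c1 := one_sub_sqr_half_le_cos (ltW y0).
  have pi4 : (pi : R) / 2 < 2 := pihalf_lt2 R.
  (* Bernoulli's inequality requires y^2 / 2 <= 1; otherwise 1 - m y^2 is negative and the claim is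
     trivial. *)
  have [h|h] := lerP (y ^+ 2 / 2) 1; last first.
    rewrite (le_trans (y := 0)) ?exprn_ge0 ?(ltW cy0) // subr_le0.
    rewrite (_ : x ^+ 2 / _ = m%:R * y ^+ 2); last by rewrite xy; field; rewrite gt_eqF.
    nra.
  apply: (@le_trans _ _ ((1 - y ^+ 2 / 2) ^+ (2 * m))).
    rewrite (le_trans _ (bernoulli_sub_le _ _)) //; last by rewrite h divr_ge0 // sqr_ge0.
    rewrite natrM [X in 1 - X](_ : _ = 2 * m%:R * (y ^+ 2 / 2)) //.
    by rewrite xy; field; rewrite gt_eqF.
  by rewrite lerXn2r // nnegrE ?(ltW cy0) // subr_ge0.
have step : x * A * (cos y ^+ 2) ^+ m <= 2 * m%:R * sin y * cos y * B.
  apply: (@le_trans _ _ (2 * m%:R * (y * cos y) * cos y * ((cos y ^+ 2) ^+ (m - 1) * A))).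
    have -> : (cos y ^+ 2) ^+ m = cos y ^+ 2 * (cos y ^+ 2) ^+ (m - 1).
      by rewrite -exprS subn1 prednK.
    rewrite {1}xy; set c := (cos y ^+ 2) ^+ (m - 1).
    by rewrite le_eqVlt; apply/orP; left; apply/eqP; ring.
  apply: ler_pM => //.
  - by rewrite !mulr_ge0 // ltW.
  - by rewrite mulr_ge0 // exprn_ge0 // sqr_ge0.
  - by rewrite ler_wpM2r ?(ltW cy0) // ler_wpM2l // mulr_ge0.
apply: le_trans step; rewrite ler_wpM2l // mulr_ge0 //; exact: ltW.
Qed.

(** The partial products decrease, so an arbitrary index is compared with a larger power of 2 for
    the lower bound and with a smaller one for the upper bound. *)
Lemma sin_partial_prod_bounds_all (R : realType) (x : R) (m : nat) : 0 < x < pi ->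
  sin x / x <= sin_partial_prod x m.+1 <= sin x / x + x ^+ 2 / 2 * m.+1%:R^-1.
Proof.
move=> xp; have /andP[x0 xpi] := xp.
have nincr i j : (0 < i <= j)%N -> 0 <= sin_partial_prod x j <= sin_partial_prod x i.
  move=> /andP[i0 ij]; rewrite /sin_partial_prod (@big_cat_nat _ _ _ i _ j) //=.
  have A0 : 0 <= \prod_(1 <= k < i) (1 - (x / (k%:R * pi)) ^+ 2).
    rewrite big_seq; apply: prodr_ge0 => k; rewrite mem_index_iota => /andP[k0 _].
    by have /andP[] := sin_partial_prod_factor xp k0.
  have fk k : (i <= k < j)%N -> 0 <= 1 - (x / (k%:R * pi)) ^+ 2 <= 1.
    by move=> /andP[ik _]; rewrite sin_partial_prod_factor // (leq_trans i0).
  rewrite mulr_ge0 //= ?ler_piMr // big_seq; first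
    by apply: prodr_ile1 => k; rewrite mem_index_iota; exact: fk.
  by apply: prodr_ge0 => k; rewrite mem_index_iota => /fk /andP[].
have le1 i : (0 < i)%N -> sin_partial_prod x i <= 1.
  move=> i0; have := nincr 1%N i; rewrite i0 => /(_ isT) /andP[_].
  by rewrite {2}/sin_partial_prod big_geq.
apply/andP; split.
  have [h _] := sin_partial_prod_bounds m.+1 xp.
  rewrite ler_pdivrMr // mulrC (le_trans h) // ler_wpM2l ?(ltW x0) //.
  by have /andP[] := nincr m.+1 (2 ^ m.+1)%N (ltnW (@ltn_expl 2 m.+1 isT)).
(* The largest power [p] of 2 satisfies p <= m + 1 < 2 p, so the error x^2 / (4 p) is at most x^2 /
   (2 (m + 1)). *)
have /andP[pm mp] := @trunc_log_bounds 2 m.+1 isT isT.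
have [_] := sin_partial_prod_bounds (trunc_log 2 m.+1) xp.
move: pm mp; rewrite expnS.
have : (0 < 2 ^ trunc_log 2 m.+1)%N by rewrite expn_gt0.
move: (2 ^ trunc_log 2 m.+1)%N => p p0 pm mp hp.
have pR : (0 : R) < p%:R by rewrite ltr0n.
have /andP[_ h] := nincr p m.+1 (introT andP (conj p0 pm)).
apply: (le_trans h).
have := le1 p p0; have /andP[A0 _] := nincr p p (introT andP (conj p0 (leqnn p))).
move: hp; set A := sin_partial_prod x p => hp A1.
have e : A <= sin x / x + A * (x ^+ 2 / (4 * p%:R)).
  rewrite -lerBlDr ler_pdivlMr //; apply: le_trans hp.
  by rewrite le_eqVlt; apply/orP; left; apply/eqP; ring.
apply: (le_trans e); rewrite lerD2l.
have q0 : 0 <= x ^+ 2 / (4 * p%:R) by rewrite divr_ge0 ?sqr_ge0 // mulr_ge0 // ltW.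
apply: (@le_trans _ _ (x ^+ 2 / (4 * p%:R))); first by rewrite ler_piMl.
rewrite -[X in _ <= X]mulrA -invfM; apply: ler_wpM2l; first exact: sqr_ge0.
rewrite lef_pV2 ?posrE ?mulr_gt0 // -natrM -natrM ler_nat.
lia.
Qed.

Lemma sin_prod_cvg (R : realType) (z : R) : 0 < z < 1 ->
  \prod_(i < n) (1 - (z / i.+1%:R) ^+ 2) @[n --> \oo] --> sin (pi * z) / (pi * z).
Proof.
move=> /andP[z0 z1]; have pi0 := pi_gt0 R.
have xp : 0 < pi * z < pi by rewrite mulr_gt0 //= gtr_pMr.
have E n : \prod_(i < n) (1 - (z / i.+1%:R) ^+ 2) = sin_partial_prod (pi * z) n.+1.
  rewrite /sin_partial_prod big_add1 big_mkord; apply: eq_bigr => i _.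
  by rewrite [_ * pi]mulrC -mulf_div divff ?mul1r // gt_eqF.
rewrite (_ : (fun n => _) = fun n => sin_partial_prod (pi * z) n.+1); last exact/funext.
apply: (@squeeze_cvgr _ _ _ _ (cst (sin (pi * z) / (pi * z)))
  (fun n => sin (pi * z) / (pi * z) + (pi * z) ^+ 2 / 2 * n.+1%:R^-1)).
- by apply: nearW => n; exact: sin_partial_prod_bounds_all.
- exact: cvg_cst.
- rewrite -[X in _ --> X]addr0; apply: cvgD; first exact: cvg_cst.
  rewrite -(mulr0 ((pi * z) ^+ 2 / 2)); apply: cvgM; first exact: cvg_cst.
  exact: cvg_harmonic.
Qed.

(** * The reflection formula for Gauss's limit *)

Definition nonint (R : realType) (x : R) := forall z : int, x != z%:~R.

Lemma nonintD (R : realType) (x : R) (z : int) : nonint x -> nonint (x + z%:~R).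
Proof. by move=> nx w; rewrite -subr_eq0 -addrA -opprB -rmorphB /= subr_eq0. Qed.

Lemma nonintN (R : realType) (x : R) : nonint x -> nonint (- x).
Proof. by move=> nx w; rewrite eqr_oppLR -rmorphN; exact: nx. Qed.

(** * Monotonicity and functional equations of Gauss's sequence *)

Lemma Gamma_seq_gt0 (R : realType) (x : R) (n : nat) : 0 < x -> 0 < Gamma_seq x n.+1.
Proof.
move=> x0; apply: divr_gt0.
  by apply: mulr_gt0; rewrite ?powR_gt0 // ltr0n fact_gt0.
by apply: prodr_gt0 => i _; rewrite ltr_wpDr.
Qed.

(** The inequality behind the growth of Gauss's sequence. With r = 1 - 1 / (n + 2) it says r^x (1 +
    x / (n + 2)) <= 1, which follows from 1 + u <= e^u and ln (1 + u) <= u. *)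
Lemma powR_succ_ge (R : realType) (x : R) (n : nat) : 0 < x ->
  n.+1%:R `^ x * (x + n.+2%:R) <= n.+2%:R `^ x * n.+2%:R.
Proof.
move=> x0; have n2 : (0 : R) < n.+2%:R by rewrite ltr0n.
pose r : R := 1 + - n.+2%:R^-1.
have rE : n.+1%:R = n.+2%:R * r.
  by rewrite /r mulrDr mulr1 mulrN divff ?gt_eqF // -[n.+2%:R]natr1 addrK.
have r0 : 0 < r by move: (ltr0n R n.+1); rewrite rE pmulr_rgt0.
have rx : r `^ x * (1 + x / n.+2%:R) <= 1.
  rewrite /powR gt_eqF // (le_trans (ler_wpM2l (expR_ge0 _) (expR_ge1Dx (x / n.+2%:R)))) //.
  rewrite -expRD -[X in _ <= X]expR0 ler_expR -mulrDr pmulr_rle0 //.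
  rewrite addrC -[X in _ + X]opprK subr_le0 lerNr le_ln1Dx //.
  by rewrite -subr_gt0 opprK addrC.
rewrite rE powRM ?(ltW n2) ?(ltW r0) // -mulrA ler_wpM2l ?powR_ge0 //.
have -> : x + n.+2%:R = (1 + x / n.+2%:R) * n.+2%:R by field; rewrite gt_eqF.
by rewrite mulrA ler_piMl ?(ltW n2).
Qed.

Lemma Gamma_seq_nondecreasing (R : realType) (x : R) (n : nat) : 0 < x ->
  Gamma_seq x n.+1 <= Gamma_seq x n.+2.
Proof.
move=> x0; rewrite /Gamma_seq [in X in _ <= X]big_ord_recr /=.
set P := \prod_(i < n.+2) _.
have P0 : 0 < P by apply: prodr_gt0 => i _; rewrite ltr_wpDr.
have q0 : 0 < x + n.+2%:R by rewrite ltr_wpDr.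
have F0 : (0 : R) < n.+1`!%:R by rewrite ltr0n fact_gt0.
rewrite [n.+2`!]factS natrM ler_pdivrMr //.
have -> : n.+2%:R `^ x * (n.+2%:R * n.+1`!%:R) / (P * (x + n.+2%:R)) * P =
  n.+2%:R `^ x * n.+2%:R * n.+1`!%:R / (x + n.+2%:R).
  by move: (x + _) q0 => q q0; field; rewrite (gt_eqF P0) (gt_eqF q0).
by rewrite ler_pdivlMr // mulrAC ler_pM2r // powR_succ_ge.
Qed.

(** Taken at index [n.+1] so that the base of the power is nonzero and exponents add. *)
Lemma Gamma_seqD1 (R : realType) (x : R) (n : nat) : nonint x ->
  Gamma_seq (x + 1) n.+1 = x * (n.+1%:R / (x + n.+2%:R)) * Gamma_seq x n.+1.
Proof.
move=> nx; rewrite /Gamma_seq.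
rewrite [in RHS]big_ord_recl [in LHS]big_ord_recr /=.
set P := \prod_(i < n.+1) (x + 1 + i%:R).
have -> : \prod_(i < n.+1) (x + (bump 0 i)%:R) = P.
  by apply: eq_bigr => i _; rewrite /bump /= natrD addrA.
have P0 : P != 0.
  by apply/prodf_neq0 => i _; have := nonintD (i.+1%:Z) nx 0; rewrite -addrA nat1r.
have x0 : x != 0 by exact: nx 0.
have xn : x + n.+2%:R != 0 by exact: (nonintD n.+2%:Z nx 0).
rewrite powRD ?pnatr_eq0 ?implybT // powRr1 // addr0.
have -> : x + 1 + n.+1%:R = x + n.+2%:R by rewrite -addrA nat1r.
move: (n.+1%:R `^ x) (x + _) xn => a q q0.
by field; rewrite x0 P0 q0.
Qed.

(** The factors pair up as (j + x) (j - x) = j^2 (1 - (x / j)^2) with j = i + 1. *)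
Lemma prod_refl (R : realFieldType) (x : R) (n : nat) :
  (\prod_(i < n) (x + i.+1%:R)) * (\prod_(i < n) (1 - x + i%:R)) =
  n`!%:R ^+ 2 * \prod_(i < n) (1 - (x / i.+1%:R) ^+ 2).
Proof.
elim: n => [|n IHn]; first by rewrite !big_ord0 fact0 expr1n !mulr1.
rewrite !big_ord_recr /= mulrACA {}IHn factS natrM -natr1.
have n0 : n%:R + 1 != 0 :> R by rewrite natr1 pnatr_eq0.
move: (\prod_(i < n) _) => p; by field.
Qed.

(** The powers combine to n + 1. Outside the pairs of [prod_refl] remain the first factor [x] of one
    denominator and the last factor n + 2 - x of the other. *)
Lemma Gamma_seq_refl (R : realType) (x : R) (n : nat) : nonint x ->
  Gamma_seq x n.+1 * Gamma_seq (1 - x) n.+1 =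
  n.+1%:R / (n.+2%:R - x) / (x * \prod_(i < n.+1) (1 - (x / i.+1%:R) ^+ 2)).
Proof.
move=> nx; rewrite /Gamma_seq.
rewrite [\prod_(i < _) (x + _)]big_ord_recl [\prod_(i < _) (1 - x + _)]big_ord_recr /=.
have := prod_refl x n.+1.
have -> : \prod_(i < n.+1) (x + (bump 0 i)%:R) = \prod_(i < n.+1) (x + i.+1%:R) by [].
have : \prod_(i < n.+1) (x + i.+1%:R) != 0.
  by apply/prodf_neq0 => i _; exact: (nonintD i.+1%:Z nx 0).
have : \prod_(i < n.+1) (1 - x + i%:R) != 0.
  apply/prodf_neq0 => i _; rewrite addrAC nat1r addrC.
  exact: (nonintD i.+1%:Z (nonintN nx) 0).
move: (\prod_(i < n.+1) (x + _)) (\prod_(i < n.+1) (1 - x + _)) => a b b0 a0 ab.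
have F0 : n.+1`!%:R != 0 :> R by rewrite pnatr_eq0 -lt0n fact_gt0.
have := ab; set p := \prod_(i < n.+1) _ => {}ab.
have p0 : p != 0.
  by have : a * b != 0 by [rewrite mulf_neq0]; rewrite ab mulf_eq0 negb_or => /andP[].
have x0 : x != 0 by exact: nx 0.
have xn : n.+2%:R - x != 0 by rewrite addrC; exact: (nonintD n.+2%:Z (nonintN nx) 0).
have N0 : n.+1%:R != 0 :> R by rewrite pnatr_eq0.
rewrite powRB ?N0 ?implybT // powRr1 // addr0.
have -> : 1 - x + n.+1%:R = n.+2%:R - x by rewrite addrAC nat1r.
have : n.+1%:R `^ x != 0 :> R by rewrite powR_eq0 negb_and N0.
move: (n.+1%:R `^ x) => w w0.
have -> : b = n.+1`!%:R ^+ 2 * p / a by rewrite -ab; field.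
move: (n.+2%:R - x) xn (n.+1`!%:R) F0 => q q0 F F0.
by field; rewrite w0 F0 x0 a0 p0 q0.
Qed.

Lemma cvg_shifted_ratio (R : realType) (c : R) :
  n.+1%:R / (c + n.+2%:R) @[n --> \oo] --> (1 : R).
Proof.
rewrite (_ : (fun n => _) = fun n => (1 + (1 + c) * n.+1%:R^-1)^-1); last first.
  apply/funext => n; rewrite -invf_div; congr (_^-1).
  have n0 : n.+1%:R != 0 :> R by rewrite pnatr_eq0.
  by rewrite -[n.+2%:R]natr1 addrA mulrDl mulrDl mulrDl divff //; ring.
rewrite -[X in _ --> X]invr1; apply: cvgV; first exact: oner_neq0.
rewrite -[X in _ --> X]addr0; apply: cvgD; first exact: cvg_cst.
rewrite -[X in _ --> X](mulr0 (1 + c)); apply: cvgM; first exact: cvg_cst.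
exact: cvg_harmonic.
Qed.

Lemma Gamma_seq_cvgD1 (R : realType) (x : R) : nonint x ->
  cvgn (Gamma_seq x) ->
  cvgn (Gamma_seq (x + 1)) /\ Gamma (x + 1) = x * Gamma x.
Proof.
move=> nx cx.
have c : Gamma_seq (x + 1) @ \oo --> x * Gamma x.
  rewrite -(cvg_shiftS (Gamma_seq (x + 1))) /=.
  rewrite (_ : (fun n => _) = fun n => x * (n.+1%:R / (x + n.+2%:R)) * Gamma_seq x n.+1).
    rewrite -[X in X * Gamma x]mulr1; apply: cvgM.
      by apply: cvgM; [exact: cvg_cst|exact: cvg_shifted_ratio].
    by rewrite (cvg_shiftS (Gamma_seq x)).
  by apply/funext => n; rewrite Gamma_seqD1.
by split; [apply/cvg_ex; eexists; exact: c|exact/cvg_lim].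
Qed.

Lemma Gamma_seq_cvgB1 (R : realType) (x : R) : nonint x ->
  cvgn (Gamma_seq (x + 1)) -> cvgn (Gamma_seq x).
Proof.
(* The 1 in the witness is the limit of the ratio in [Gamma_seqD1], which is inverted here. *)
move=> nx /cvg_ex[l cl]; apply/cvg_ex; exists ((x * 1)^-1 * l).
have x0 : x != 0 by exact: nx 0.
rewrite -(cvg_shiftS (Gamma_seq x)) /=.
rewrite (_ : (fun n => _) = fun n => (x * (n.+1%:R / (x + n.+2%:R)))^-1 * Gamma_seq (x + 1) n.+1).
  apply: cvgM; last by rewrite (cvg_shiftS (Gamma_seq (x + 1))).
  apply: cvgV; first by rewrite mulr1.
  by apply: cvgM; [exact: cvg_cst|exact: cvg_shifted_ratio].
apply/funext => n; rewrite Gamma_seqD1 // mulKf // !mulf_neq0 ?invr_eq0 ?pnatr_eq0 //.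
exact: (nonintD n.+2%:Z nx 0).
Qed.

(** * Reflection on the unit interval and its extension to all non-integers *)

Lemma nonint_itv01 (R : realType) (x : R) : 0 < x < 1 -> nonint x.
Proof.
move=> /andP[x0 x1] z; apply/eqP => xz; move: x0 x1; rewrite xz.
by rewrite ltr0z ltrz1; lia.
Qed.

(** Concerns the product of the two sequences, because the convergence of each one is deduced from
    it. *)
Lemma Gamma_seq_refl_cvg (R : realType) (x : R) : 0 < x < 1 ->
  Gamma_seq x n.+1 * Gamma_seq (1 - x) n.+1 @[n --> \oo] --> pi / sin (pi * x).
Proof.
move=> x01; have /andP[x0 x1] := x01; have pi0 := pi_gt0 R.
have s0 : 0 < sin (pi * x) by rewrite sin_gt0_pi // mulr_gt0 //= gtr_pMr.
rewrite (_ : (fun n => _) = fun n => n.+1%:R / (- x + n.+2%:R) /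
   (x * \prod_(i < n.+1) (1 - (x / i.+1%:R) ^+ 2))); last first.
  apply/funext => n; rewrite Gamma_seq_refl; last exact: nonint_itv01.
  by rewrite [- x + _]addrC.
have -> : pi / sin (pi * x) = 1 / (x * (sin (pi * x) / (pi * x))).
  move: (sin _) s0 => s s0; move: (pi : R) pi0 => p p0.
  by field; rewrite (gt_eqF p0) (gt_eqF s0) (gt_eqF x0).
apply: cvgM; first exact: cvg_shifted_ratio.
apply: cvgV; first by rewrite gt_eqF // !(mulr_gt0, invr_gt0).
apply: cvgM; first exact: cvg_cst.
rewrite (cvg_shiftS (fun n => \prod_(i < n) (1 - (x / i.+1%:R) ^+ 2))).
exact: sin_prod_cvg.
Qed.

(* Gauss's sequence increases; since its product with the one at [1 - x]
   converges and that one is bounded below, it is bounded. *)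
Lemma Gamma_seq_cvg01 (R : realType) (x : R) : 0 < x < 1 -> cvgn (Gamma_seq x).
Proof.
move=> x01; have /andP[x0 x1] := x01.
have mon y : 0 < y -> nondecreasing_seq (fun n => Gamma_seq (y : R) n.+1).
  by move=> y0; apply/nondecreasing_seqP => n; exact: Gamma_seq_nondecreasing.
have y0 : 0 < 1 - x by rewrite subr_gt0.
have : cvgn (fun n => Gamma_seq x n.+1 * Gamma_seq (1 - x) n.+1).
  by apply/cvg_ex; eexists; exact: Gamma_seq_refl_cvg.
move=> /cvg_seq_bounded/bounded_fun_has_ubound[M Mub].
suff : cvgn (fun n => Gamma_seq x n.+1).
  by move=> /cvg_ex[l cl]; apply/cvg_ex; exists l; rewrite -(cvg_shiftS (Gamma_seq x)).
apply: nondecreasing_is_cvgn; first exact: mon.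
exists (M / Gamma_seq (1 - x) 1) => _ [n _ <-].
rewrite ler_pdivlMr ?Gamma_seq_gt0 //.
apply: (@le_trans _ _ (Gamma_seq x n.+1 * Gamma_seq (1 - x) n.+1)).
  by rewrite ler_wpM2l ?(ltW (Gamma_seq_gt0 _ _)) // (mon _ y0 0%N n).
by apply: Mub; exists n.
Qed.

(** Convergence is carried along with the identity: [Gamma] is a [limn], which obeys the functional
    equation only once the sequence is known to converge. *)
Definition reflection_at (R : realType) (x : R) :=
  [/\ cvgn (Gamma_seq x), cvgn (Gamma_seq (1 - x)) &
      Gamma x * Gamma (1 - x) = pi / sin (pi * x)].

Lemma reflection_at01 (R : realType) (x : R) : 0 < x < 1 -> reflection_at x.
Proof.
move=> x01; have /andP[x0 x1] := x01.
have cx := Gamma_seq_cvg01 x01.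
have cy : cvgn (Gamma_seq (1 - x)) by apply: Gamma_seq_cvg01; apply/andP; split; lra.
split=> //; rewrite -(cvg_lim _ (Gamma_seq_refl_cvg x01)) //.
apply/esym/cvg_lim => //; apply: cvgM.
  by rewrite (cvg_shiftS (Gamma_seq x)).
by rewrite (cvg_shiftS (Gamma_seq (1 - x))).
Qed.

Lemma reflection_at_sym (R : realType) (x : R) :
  reflection_at x -> reflection_at (1 - x).
Proof.
move=> [c1 c2 e]; rewrite /reflection_at subKr; split=> //.
by rewrite mulrC e mulrBr mulr1 sinB sinpi cospi; congr (_ / _); ring.
Qed.

(** As 1 - (x + 1) = - x, the functional equation is used at [x] and, backwards, at [- x]. The
    quotient x / (- x) = -1 matches the sign of sin (pi x + pi). *)
Lemma reflection_atD1 (R : realType) (x : R) : nonint x ->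
  reflection_at x -> reflection_at (x + 1).
Proof.
move=> nx [c1 c2 e].
have nNx : nonint (- x) := nonintN nx.
have E : 1 - (x + 1) = - x by ring.
have E1 : 1 - x = - x + 1 by rewrite addrC.
have [c3 g3] := Gamma_seq_cvgD1 nx c1.
have c4 : cvgn (Gamma_seq (- x)) by apply: Gamma_seq_cvgB1; rewrite -?E1.
have [_ g4] := Gamma_seq_cvgD1 nNx c4.
rewrite /reflection_at E; split=> //.
rewrite mulrDr mulr1 sinDpi invrN mulrN -e E1 g4 g3; ring.
Qed.

(** Upward steps from the fractional part [f] reach every [x] with floor >= 0. For a negative floor,
    1 - x is reached upwards from 1 - f and then reflected. *)
Lemma nonint_ind (R : realType) (P : R -> Prop) :
  (forall x, 0 < x < 1 -> P x) -> (forall x, P x -> P (1 - x)) ->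
  (forall x, nonint x -> P x -> P (x + 1)) ->
  forall x, nonint x -> P x.
Proof.
move=> P01 Psym PD1.
have up (f : R) n : 0 < f < 1 -> P (f + n%:R).
  move=> f01; elim: n => [|n IHn]; first by rewrite addr0; exact: P01.
  rewrite -natr1 addrA; apply: PD1 => //.
  exact: (nonintD n%:Z (nonint_itv01 f01)).
move=> x nx; have /andP[x0 x1] := floor_itv x.
pose f := x - (Num.floor x)%:~R.
have f01 : 0 < f < 1.
  rewrite /f subr_gt0 ltrBlDl lt_neqAle x0 eq_sym nx /=.
  by rewrite rmorphD in x1.
have -> : x = f + (Num.floor x)%:~R by rewrite subrK.
case: (Num.floor x) => n; first exact: up.
have -> : f + (Negz n)%:~R = 1 - (1 - f + n.+1%:R) by rewrite NegzE rmorphN /=; ring.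
apply/Psym/up; move: f01 => /andP[? ?]; apply/andP; split; lra.
Qed.

Theorem Gamma_reflection (R : realType) (x : R) : nonint x ->
  Gamma x * Gamma (1 - x) = pi / sin (pi * x).
Proof.
move=> nx; suff [] : reflection_at x by [].
by apply: nonint_ind nx; [exact: reflection_at01
  |exact: reflection_at_sym|exact: reflection_atD1].
Qed.

Lemma sin_pi_nonint (R : realType) (x : R) : nonint x -> sin (pi * x) != 0.
Proof.
apply: (@nonint_ind _ (fun x => sin (pi * x) != 0)) => [{}x /andP[x0 x1]|{}x|{}x _].
- by rewrite gt_eqF // sin_gt0_pi // mulr_gt0 ?pi_gt0 //= gtr_pMr // pi_gt0.
- by rewrite mulrBr mulr1 sinB sinpi cospi mul0r sub0r mulN1r opprK.
- by rewrite mulrDr mulr1 sinDpi oppr_eq0.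
Qed.

(** * The product of the connection coefficients *)

Lemma cos_pi_third (R : realType) : cos (pi / 3 : R) = 1 / 2.
Proof.
have pi0 := pi_gt0 R; set c := cos (pi / 3).
have c0 : 0 < c by rewrite cos_gt0_pihalf //; apply/andP; split; lra.
have : cos ((pi / 3) *+ 2) = - c :> R.
  have -> : (pi / 3) *+ 2 = pi - pi / 3 :> R by rewrite mulr2n; lra.
  by rewrite cosB cospi sinpi mul0r addr0 mulN1r.
rewrite cos_mulr2n -/c mulr2n => e.
have : (2 * c - 1) * (c + 1) = 0 by move: e; lra.
move/eqP; rewrite mulf_eq0 => /orP[|] /eqP; lra.
Qed.

Lemma sin_pi_sixth (R : realType) : sin (pi / 6 : R) = 1 / 2.
Proof.
have pi0 := pi_gt0 R.
by rewrite -cosBpihalf -cos_pi_third -[in RHS]cosN; congr cos; lra.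
Qed.

Lemma ratr_nonint (R : realType) (q : rat) :
  (forall z : int, q != z%:~R) -> nonint (ratr q : R).
Proof. by move=> nq z; rewrite -(ratr_int R) fmorph_eq. Qed.

Section GammaProduct.
Variables (R : realType) (k : rat).
Hypotheses (hk0 : ~ cong12 k 0) (hk4 : ~ cong12 k 4).
Hypotheses (hk5 : ~ cong12 k 5) (hk11 : ~ cong12 k 11) (hG : G_defined k).
Let kR : R := ratr k.

Lemma cong12N (m : int) : ~ cong12 k m -> nonint ((kR - m%:~R) / 12).
Proof.
move=> km; have -> : (kR - m%:~R) / 12 = ratr ((k - m%:~R) / 12) :> R.
  by rewrite fmorph_div rmorphB /= ratr_int ratr_nat.
apply: ratr_nonint => z; apply/eqP => e; apply: km; exists z.
by rewrite -e; field.
Qed.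

(** The classes 5 and 11 modulo 12 together form the class of -1 modulo 6, according to the parity
    of [z] in k = 6 z - 1. *)
Lemma nonint_one_add_div6 : nonint ((1 + kR) / 6).
Proof.
have -> : (1 + kR) / 6 = ratr ((1 + k) / 6) :> R.
  by rewrite fmorph_div rmorphD /= rmorph1 ratr_nat.
apply: ratr_nonint => z; apply/eqP => e.
have kz : k = 6 * z%:~R - 1 by rewrite -e; field.
have zE := divz_eq z 2; have := modz_ge0 z (isT : (2 : int) != 0).
have := ltz_mod z (isT : (2 : int) != 0).
move: (modz z 2) zE => r zE; rewrite /= => r2 r0.
have [r0'|r1] : r = 0 \/ r = 1 by lia.
  apply: hk11; exists ((z %/ 2)%Z - 1); rewrite kz [in LHS]zE r0' addr0 intrM intrB.
  by move: (z %/ 2)%Z => w; ring.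
apply: hk5; exists (z %/ 2)%Z; rewrite kz [in LHS]zE r1 intrD intrM.
by move: (z %/ 2)%Z => w; ring.
Qed.

(** An integer is at most 0, hence a pole, or at least 1, and then 1 - x is a pole. The Gamma
    arguments in the denominators of [G12] and [G21] come in such pairs. *)
Lemma nonint_of_poles (x : rat) : ~ Gamma_pole x -> ~ Gamma_pole (1 - x) ->
  nonint (ratr x : R).
Proof.
move=> px p1x; apply: ratr_nonint => z; apply/eqP => e.
have [z0|z0] := lerP z 0.
  apply: px; exists `|z|%N; rewrite e -[LHS]opprK -rmorphN; congr (- _).
  by rewrite -[in LHS](ler0_norm z0) -abszE.
apply: p1x; exists `|z - 1|%N; rewrite e -[LHS]opprK opprB; congr (- _).
have z1 : 0 <= z - 1 by lia.
by rewrite -(rmorphB _ z 1) /= -[in LHS](ger0_norm z1) -abszE.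
Qed.

Lemma nonint_two_add_div12 : nonint ((2 + kR) / 12).
Proof.
have -> : (2 + kR) / 12 = ratr ((2 + k) / 12) :> R.
  by rewrite fmorph_div rmorphD /= !ratr_nat.
apply: nonint_of_poles.
  apply: hG; rewrite !in_cons; apply/orP; right; by apply/orP; left; rewrite eqxx.
have -> : 1 - (2 + k) / 12 = (10 - k) / 12 by field.
apply: hG; rewrite !in_cons; do 5 (apply/orP; right); by apply/orP; left; rewrite eqxx.
Qed.

Lemma nonint_six_add_div12 : nonint ((6 + kR) / 12).
Proof.
have -> : (6 + kR) / 12 = ratr ((6 + k) / 12) :> R.
  by rewrite fmorph_div rmorphD /= !ratr_nat.
apply: nonint_of_poles.
  apply: hG; rewrite !in_cons; do 2 (apply/orP; right); by apply/orP; left; rewrite eqxx.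
have -> : 1 - (6 + k) / 12 = (6 - k) / 12 by field.
apply: hG; rewrite !in_cons; do 4 (apply/orP; right); by apply/orP; left; rewrite eqxx.
Qed.

Lemma sin_theta_neq0 : sin (theta R k) != 0.
Proof. by rewrite /theta mulrC; apply: sin_pi_nonint; exact: nonint_one_add_div6. Qed.

(** The six Gamma arguments form three pairs [x], [1 - x], so three reflections apply and all powers
    of [pi] cancel. *)
Lemma G12_G21_mul :
  G12 R k * G21 R k =
  sin (pi * ((2 + kR) / 12)) * sin (pi * ((6 + kR) / 12)) / (8 * sin (theta R k)).
Proof.
rewrite /G12 /G21 -/kR.
have -> : (5 - kR) / 6 = 1 - (1 + kR) / 6 by lra.
have -> : (6 - kR) / 12 = 1 - (6 + kR) / 12 by lra.
have -> : (10 - kR) / 12 = 1 - (2 + kR) / 12 by lra.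
have e6 := Gamma_reflection nonint_one_add_div6; have e2 := Gamma_reflection nonint_two_add_div12.
have e6' := Gamma_reflection nonint_six_add_div12.
have s6 := sin_theta_neq0.
have s2 := sin_pi_nonint nonint_two_add_div12; have s6' := sin_pi_nonint nonint_six_add_div12.
rewrite -[theta R k]/((1 + kR) / 6 * pi) [_ * pi]mulrC in s6 *.
have q := sqr_sqrtr (pi_ge0 R).
transitivity (Num.sqrt pi ^+ 2 * (Gamma ((1 + kR) / 6) * Gamma (1 - (1 + kR) / 6)) /
  (8 * (Gamma ((2 + kR) / 12) * Gamma (1 - (2 + kR) / 12)) *
   (Gamma ((6 + kR) / 12) * Gamma (1 - (6 + kR) / 12)))).
  rewrite mulf_div mulrACA -expr2; congr (_ / _).
  by move: (Gamma _) (Gamma _) (Gamma _) (Gamma _) => *; ring.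
rewrite q e6 e2 e6'.
have pi0 : (pi : R) != 0 by rewrite gt_eqF // pi_gt0.
move: (sin (pi * ((1 + kR) / 6))) s6 (sin (pi * ((2 + kR) / 12))) s2.
move: (sin (pi * ((6 + kR) / 12))) s6' => s h s' h' s'' h''.
move: (pi : R) pi0 => p p0.
by field; rewrite h h' h'' p0.
Qed.

Lemma G12_G21_neq0 : G12 R k * G21 R k != 0.
Proof.
rewrite G12_G21_mul mulf_neq0 ?invr_eq0 ?mulf_neq0 ?pnatr_eq0 ?sin_theta_neq0 //.
- exact: sin_pi_nonint nonint_two_add_div12.
- exact: sin_pi_nonint nonint_six_add_div12.
Qed.

(** Product-to-sum formula: the two angles differ by pi / 3 and add up to theta + pi / 2. *)
Lemma G12_G21_csc : 16 * (G12 R k * G21 R k) = 1 + (sin (theta R k))^-1 / 2.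
Proof.
have pi0 := pi_gt0 R; have t0 := sin_theta_neq0.
pose a := pi * ((2 + kR) / 12); pose b := pi * ((6 + kR) / 12).
have ab : cos (b - a) - cos (b + a) = 1 / 2 + sin (theta R k).
  rewrite (_ : b - a = pi / 3); last by rewrite /a /b; lra.
  rewrite cos_pi_third (_ : b + a = theta R k + pi / 2); last by rewrite /a /b /theta -/kR; lra.
  by rewrite cosDpihalf opprK.
have sc : sin a * sin b = (1 / 2 + sin (theta R k)) / 2.
  by move: ab; rewrite cosB cosD; lra.
rewrite G12_G21_mul -/a -/b sc.
by move: (sin _) t0 => s s0; field.
Qed.

(** sin theta - sin (pi / 6) = 2 cos (pi (2 + k) / 12) sin (pi k / 12). The cosine vanishes only for
    k = 4 and the sine only for k = 0 modulo 12. *)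
Lemma csc_theta_neq2 : (sin (theta R k))^-1 != 2.
Proof.
apply/eqP => e; have pi0 := pi_gt0 R.
have s : sin (theta R k) = 1 / 2 by rewrite -[LHS]invrK e div1r.
have := sin_pi_nonint (cong12N hk0); have := sin_pi_nonint (cong12N hk4).
have -> : sin (pi * ((kR - 4%:~R) / 12)) = - cos (pi * ((2 + kR) / 12)).
  by rewrite -sinBpihalf; congr sin; lra.
rewrite oppr_eq0 subr0 => /mulf_neq0 h /h; apply/negP; rewrite negbK.
have : sin (pi * ((2 + kR) / 12) + pi * (kR / 12)) -
       sin (pi * ((2 + kR) / 12) - pi * (kR / 12)) = 0.
  rewrite (_ : _ - pi * (kR / 12) = pi / 6); last by lra.
  rewrite (_ : _ + pi * (kR / 12) = theta R k); last by rewrite /theta -/kR; lra.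
  by rewrite s sin_pi_sixth subrr.
rewrite sinD sinB => e0; apply/eqP; move: e0; lra.
Qed.
End GammaProduct.

(** * The connection matrices *)

Lemma mx2E (R : realType) (a b c d : R[i]) :
  (mx2 a b c d 0 0 = a) * (mx2 a b c d 0 1 = b) *
  (mx2 a b c d 1 0 = c) * (mx2 a b c d 1 1 = d).
Proof. by rewrite !mxE. Qed.

Lemma mx2_inj (R : realType) (a b c d a' b' c' d' : R[i]) :
  mx2 a b c d = mx2 a' b' c' d' -> [/\ a = a', b = b', c = c' & d = d'].
Proof.
move=> e; have E (i j : 'I_2) : mx2 a b c d i j = mx2 a' b' c' d' i j by rewrite e.
by split; [have := E 0 0 | have := E 0 1 | have := E 1 0 | have := E 1 1]; rewrite !mx2E.
Qed.

Lemma eta_mx2 (R : realType) (M : 'M[R[i]]_2) : M = mx2 (M 0 0) (M 0 1) (M 1 0) (M 1 1).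
Proof.
apply/matrixP => i j; case: (unliftP 0 i) => [i'|] ->; case: (unliftP 0 j) => [j'|] ->;
  rewrite !mxE ?(ord1 i') ?(ord1 j') //=; congr (M _ _); exact/val_inj.
Qed.

Lemma mx2M (R : realType) (a b c d a' b' c' d' : R[i]) :
  mx2 a b c d * mx2 a' b' c' d' =
  mx2 (a * a' + b * c') (a * b' + b * d') (c * a' + d * c') (c * b' + d * d').
Proof.
by rewrite [LHS]eta_mx2 !mxE !big_ord_recl !big_ord0 !addr0 !mxE.
Qed.

Lemma mx2_1 (R : realType) : 1 = mx2 1 0 0 1 :> 'M[R[i]]_2.
Proof. by rewrite [LHS]eta_mx2 !mxE. Qed.

Lemma mx2B (R : realType) (a b c d a' b' c' d' : R[i]) :
  mx2 a b c d - mx2 a' b' c' d' = mx2 (a - a') (b - b') (c - c') (d - d').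
Proof. by rewrite [LHS]eta_mx2 !mxE. Qed.

Lemma mx2Z (R : realType) (s a b c d : R[i]) :
  s *: mx2 a b c d = mx2 (s * a) (s * b) (s * c) (s * d).
Proof. by rewrite [LHS]eta_mx2 !mxE. Qed.

(* Cayley-Hamilton: [X ^+ 3] is [(tr X)^2 - det X] times [X] plus a scalar,
   and [Y ^+ 2] is [tr Y] times [Y] plus a scalar. *)
Lemma mx2_comm_pow (R : realType) (a b c d a' b' c' d' : R[i])
    (X := mx2 a b c d) (Y := mx2 a' b' c' d') :
  X ^+ 3 * Y ^+ 2 - Y ^+ 2 * X ^+ 3 =
  (((a + d) ^+ 2 - (a * d - b * c)) * (a' + d')) *: (X * Y - Y * X).
Proof.
rewrite !exprS expr0 !mulr1 /X /Y !mx2M !mx2B mx2Z; congr mx2; ring.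
Qed.

(** * The values [Zc] and the integer powers of [rhoT] *)

Lemma Zc0 (R : realType) (k : rat) : Zc R k 0 = 1.
Proof. by rewrite /Zc mulr0 mul0r cos0 sin0. Qed.

Lemma ZcD (R : realType) (k : rat) (l m : int) : Zc R k (l + m) = Zc R k l * Zc R k m.
Proof.
rewrite /Zc intrD mulrDr mulrDl cosD sinD /GRing.mul /=.
by congr Complex; rewrite addrC; congr (_ + _); rewrite mulrC.
Qed.

Lemma Zc_neq0 (R : realType) (k : rat) (l : int) : Zc R k l != 0.
Proof.
apply/eqP => e; have := ZcD R k l (- l); rewrite subrr Zc0 e mul0r.
by move/eqP; rewrite oner_eq0.
Qed.

(** The closed form [T] is multiplicative in [t], since 1 - z z' = (1 - z') + (1 - z) z'. Negative
    powers then follow from [T (- t)] being the inverse of [T t]. *)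
Lemma rhoT_expz (R : realType) (k : rat) (t : int) :
  rhoT R k ^ t =
  mx2 1 (4 * Complex 0 1 * real_complex R (G12 R k) * (1 - Zc R k t)) 0 (Zc R k t).
Proof.
set b := 4 * _ * _; pose T (t : int) := mx2 1 (b * (1 - Zc R k t)) 0 (Zc R k t).
rewrite -/(T t).
have TD l m : T (l + m) = T l * T m by rewrite /T mx2M ZcD; congr mx2; ring.
have T0 : T 0 = 1 by rewrite /T Zc0 mx2_1 subrr mulr0.
have Tn (n : nat) : rhoT R k ^+ n = T n.
  by elim: n => [|n IHn]; rewrite ?expr0 ?T0 // exprS IHn -[rhoT R k]/(T 1) -TD.
case: t => n; first exact: Tn.
rewrite NegzE -exprnN Tn.
have u : T n.+1 \is a GRing.unit.
  by apply/unitrP; exists (T (- n.+1%:Z)); rewrite -!TD addNr subrr.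
by apply: (mulrI u); rewrite divrr // -TD subrr.
Qed.

(** * Commutation within the family [TSmx] *)

Section TriangularPair.
Variables (R : realType) (beta gamma y u v w : R[i]).

(* [rhoT ^ t * rhoS] for [w = Zc t], when [beta * gamma = - (1 + y)]. *)
Definition TSmx (z : R[i]) : 'M[R[i]]_2 :=
  mx2 (y * (1 - z) - z) (beta * (1 - z)) (- (gamma * z)) z.

Hypotheses (bg : beta * gamma = - (1 + y)) (y0 : y != 0) (y1 : y != 1).
Hypotheses (yN1 : 1 + y != 0) (w0 : w != 0).

(** The terms in y z (1 - z') cancel in the trace, leaving y^2 (1 - z) (1 - z') + z + z'. *)
Lemma TSmx_mul (z z' : R[i]) : TSmx z * TSmx z' =
  mx2 (y ^+ 2 * (1 - z) * (1 - z') - y * z * (1 - z') + z')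
      (beta * (y * (1 - z) * (1 - z') + z' - z))
      (- (gamma * (y * z * (1 - z')))) (z + y * z * (1 - z')).
Proof.
rewrite mx2M; congr mx2; try ring.
- transitivity ((y * (1 - z) - z) * (y * (1 - z') - z') - (beta * gamma) * (1 - z) * z'); first ring.
  by rewrite bg; ring.
- transitivity (z * z' - (beta * gamma) * z * (1 - z')); first ring.
  by rewrite bg; ring.
Qed.

Lemma TSmx_comm : TSmx w * (TSmx u * TSmx v) = (TSmx u * TSmx v) * TSmx w ->
  (u = 1 /\ v = 1) \/ (w = u /\ u = v).
Proof.
have [b0 g0] : beta != 0 /\ gamma != 0.
  by apply/andP; rewrite -negb_or -mulf_eq0 bg oppr_eq0.
rewrite TSmx_mul !mx2M => /mx2_inj[e11 _ e21 _].
(* In the upper left entry the products of diagonal entries cancel, and what remains has the nonzero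
   factor [beta * gamma]. *)
have I : y * (1 - v) * (u - w) = w * (v - u).
  have : beta * gamma * (y * (1 - v) * (u - w) - w * (v - u)) = 0.
    move/eqP: e11; rewrite -subr_eq0 => /eqP e; rewrite -[RHS]oppr0 -e; ring.
  by move/eqP; rewrite !mulf_eq0 (negPf b0) (negPf g0) /= subr_eq0 => /eqP.
have II : w * (u - v) + y ^+ 2 * (1 - v) * (u - w) = 0.
  have : gamma * (w * (u - v) + y ^+ 2 * (1 - v) * (u - w)) = 0.
    move/eqP: e21; rewrite -subr_eq0 => /eqP e; rewrite -e; ring.
  by move/eqP; rewrite mulf_eq0 (negPf g0) /= => /eqP.
have : y * (1 - v) * (u - w) * (y - 1) = 0.
  by rewrite -[RHS]II; move: I; rewrite -(opprB v u) mulrN => <-; ring.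
move/eqP; rewrite !mulf_eq0 (negPf y0) [y - 1 == 0]subr_eq0 (negPf y1) orbF /=.
move=> /orP[|]; rewrite subr_eq0 => /eqP h.
  left; split=> //; move: I; rewrite -h subrr mulr0 mul0r => /esym/eqP.
  by rewrite mulf_eq0 (negPf w0) /= subr_eq0 => /eqP.
right; split=> //; move: I; rewrite h subrr mulr0 => /esym/eqP.
by rewrite mulf_eq0 (negPf w0) /= subr_eq0 => /eqP.
Qed.
End TriangularPair.

(** * Specialisation to the half cosecant *)

Section HalfCosecant.
Variables (R : realType) (k : rat).
Hypotheses (hk5 : ~ cong12 k 5) (hk11 : ~ cong12 k 11) (hG : G_defined k).

Let beta : R[i] := 4 * Complex 0 1 * real_complex R (G12 R k).
Let gamma : R[i] := 4 * Complex 0 1 * real_complex R (G21 R k).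
Let y : R[i] := cscC R k / 2.

Lemma half_csc_real : y = real_complex R ((sin (theta R k))^-1 / 2).
Proof. by rewrite /y /cscC rmorphM /= [X in _ = _ * X]fmorphV /= rmorph_nat. Qed.

Lemma beta_gamma : beta * gamma = - (1 + y).
Proof.
have -> : 1 + y = real_complex R (16 * (G12 R k * G21 R k)).
  by rewrite G12_G21_csc // rmorphD rmorph1 half_csc_real.
rewrite /beta /gamma; move: (G12 R k) (G21 R k) => p q; rewrite !rmorphM.
have := sqr_i R; set i := Complex 0 1 => i2.
transitivity (16 * i ^+ 2 * (real_complex R p * real_complex R q)); first ring.
by rewrite i2 rmorph_nat; ring.
Qed.

(** This number is 16 G12 G21. It would vanish for sin theta = -1/2, that is for k = 6 or 10 modulo
    12, which [hG] rules out. *)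
Lemma one_half_csc_neq0 : 1 + y != 0.
Proof.
rewrite half_csc_real -(rmorph1 (real_complex R)) -rmorphD /= -G12_G21_csc //.
by rewrite fmorph_eq0 mulf_neq0 ?G12_G21_neq0 // pnatr_eq0.
Qed.

Lemma half_csc_neq0 : y != 0.
Proof.
by rewrite half_csc_real fmorph_eq0 mulf_neq0 ?invr_eq0 ?pnatr_eq0 // sin_theta_neq0.
Qed.

Lemma rhoT_expz_rhoS (t : int) : rhoT R k ^ t * rhoS R k = TSmx beta gamma y (Zc R k t).
Proof.
rewrite rhoT_expz /rhoS -/beta -/gamma mx2M /TSmx; congr mx2; try ring.
transitivity (- 1 - (beta * gamma) * (1 - Zc R k t)); first ring.
by rewrite beta_gamma; ring.
Qed.

Lemma csc_double : cscC R k = 2 * y.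
Proof. by rewrite /y mulrC divfK // pnatr_eq0. Qed.

(** A quarter of this is (tr X)^2 - det X for X = rhoT^t rhoS, whose trace is y (1 - w) and whose
    determinant is - w. *)
Lemma K1E (t : int) (w := Zc R k t) : K1 R k t = 4 * (y ^+ 2 * (1 - w) ^+ 2 + w).
Proof. by rewrite /K1 /Wc -/w csc_double; ring. Qed.

(** A quarter of this is the trace of the product in [TSmx_mul]. *)
Lemma K2E (r s : int) (u := Zc R k r) (v := Zc R k s) :
  K2 R k r s = 4 * (y ^+ 2 * (1 - u) * (1 - v) + u + v).
Proof. by rewrite /K2 /Wc -/u -/v csc_double; ring. Qed.

Lemma Nconn_TSmx (r s : int) :
  Nconn R k r s = (TSmx beta gamma y (Zc R k r) * TSmx beta gamma y (Zc R k s)) ^+ 2.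
Proof. by rewrite /Nconn -!rhoT_expz_rhoS !mulrA. Qed.

Lemma Mconn_Nconn_comm (t r s : int) (A := TSmx beta gamma y)
    (X := A (Zc R k t)) (Y := A (Zc R k r) * A (Zc R k s)) :
  Mconn R k t * Nconn R k r s = Nconn R k r s * Mconn R k t <->
  K1 R k t * K2 R k r s = 0 \/ X * Y = Y * X.
Proof.
have e : Mconn R k t * Nconn R k r s - Nconn R k r s * Mconn R k t =
    (K1 R k t * K2 R k r s / 16) *: (X * Y - Y * X).
  rewrite /Mconn rhoT_expz_rhoS Nconn_TSmx -/A -/X -/Y /X /Y /A.
  rewrite (TSmx_mul beta_gamma) mx2_comm_pow; congr (_ *: _).
  rewrite K1E K2E; set w := Zc R k t; set u := Zc R k r; set v := Zc R k s.
  have -> : beta * (1 - w) * - (gamma * w) = - (beta * gamma) * (1 - w) * w by ring.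
  by rewrite beta_gamma; field.
split=> [/eqP|h].
  rewrite -subr_eq0 e scaler_eq0 mulf_eq0 invr_eq0 pnatr_eq0 orbF subr_eq0.
  by move=> /orP[] /eqP; [left|right].
apply/eqP; rewrite -subr_eq0 e; case: h => ->; last by rewrite subrr scaler0.
by rewrite mul0r scale0r.
Qed.

End HalfCosecant.

Theorem theorem7p1 (R : realType) (k : rat)
    (hk0 : ~ cong12 k 0) (hk4 : ~ cong12 k 4)
    (hk5 : ~ cong12 k 5) (hk11 : ~ cong12 k 11)
    (hG : G_defined k)
    (t r s : int) (ht : t <> 0) (hr : r <> 1) (hs : s <> 1) :
  (Mconn R k t * Nconn R k r s = Nconn R k r s * Mconn R k t <->
     [\/ K1 R k t * K2 R k r s = 0,
         Zc R k r = 1 /\ Zc R k s = 1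
       | Zc R k t = Zc R k r /\ Zc R k r = Zc R k s]) /\
  (Zc R k r = 1 /\ Zc R k s = 1 -> Nconn R k r s = 1) /\
  (Zc R k t = Zc R k r /\ Zc R k r = Zc R k s ->
     Nconn R k r s = (rhoT R k ^ t * rhoS R k) ^+ 4).
Proof.
(* [TSmx] at 1 is an involution. *)
have N1 : Zc R k r = 1 /\ Zc R k s = 1 -> Nconn R k r s = 1.
  move=> [zr zs]; rewrite (Nconn_TSmx R hk5 hk11 hG) zr zs.
  rewrite (TSmx_mul (beta_gamma R hk5 hk11 hG)).
  by rewrite !(subrr, mulr0, oppr0, addr0, subr0, add0r) -mx2_1 expr1n.
have N4 : Zc R k t = Zc R k r /\ Zc R k r = Zc R k s ->
    Nconn R k r s = (rhoT R k ^ t * rhoS R k) ^+ 4.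
  move=> [ztr zrs]; rewrite (rhoT_expz_rhoS R hk5 hk11 hG) (Nconn_TSmx R hk5 hk11 hG).
  have sqr4 (A : R[i] -> 'M[R[i]]_2) (u v w : R[i]) : w = u -> u = v ->
      (A u * A v) ^+ 2 = A w ^+ 4 by move=> -> ->; rewrite -expr2 -exprM.
  exact: (sqr4 _ _ _ _ ztr zrs).
split; [split|by split].
  move=> /(Mconn_Nconn_comm R hk5 hk11 hG) [h|h]; first by constructor 1.
  have y1 : cscC R k / 2 != 1.
    rewrite half_csc_real -(rmorph1 (real_complex R)) (inj_eq (@complexI R)).
    apply: contra (csc_theta_neq2 R hk0 hk4) => /eqP e.
    by apply/eqP; rewrite -[LHS](divfK (_ : 2 != 0)) ?e ?mul1r ?pnatr_eq0.
  have [hrs|htrs] := TSmx_comm (beta_gamma R hk5 hk11 hG) (half_csc_neq0 R hk5 hk11) y1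
    (one_half_csc_neq0 R hk5 hk11 hG) (Zc_neq0 R k t) h.
    by constructor 2.
  by constructor 3.
case=> [h|h|h].
- by apply/(Mconn_Nconn_comm R hk5 hk11 hG); left.
- by rewrite (N1 h) mulr1 mul1r.
(* Both sides are the seventh power of [rhoT ^ t * rhoS]. *)
- by rewrite (N4 h) /Mconn -!exprD.
Qed.
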